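(* Let $\lambda\ge\omega_2$ be a cardinal and assume $\mu^{\omega}=\mu^+$ for each cardinal $\mu<\lambda$ with $\operatorname{cf}(\mu)=\omega$. Then $[\lambda,\kappa,\omega]\Rightarrow\omega_2$ holds for every cardinal $\kappa$ with $\omega_2\le\kappa\le\lambda$.
   Context: For a function $f$ and set $A$, $I_f(A)=\{\xi\in\operatorname{ran}(f):|A\cap f^{-1}\{\xi\}|=1\}$. A $(\lambda,\kappa,\mu)$-system is a family $\mathcal A$ with $|\mathcal A|=\lambda$, $|A|=\kappa$ for all $A\in\mathcal A$, and $|A\cap A'|<\mu$ for distinct $A,A'\in\mathcal A$. For cardinals $\lambda\ge\kappa\ge\rho\ge\omega$ and $\mu\le\kappa$, $[\lambda,\kappa,\mu]\Rightarrow\rho$ means: for every $(\lambda,\kappa,\mu)$-system $\mathcal A$ there is a function $f:\bigcup\mathcal A\to\rho$ such that $|\rho\setminus I_f(A)|<\rho$ for all $A\in\mathcal A$. *)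

(* Defs.v *)
(* cardinals are handled relationally via the
   library's [card_le] (A #<= B) on classical sets; a cardinal is represented
   by a type T (its cardinality being that of [set: T]). *)
From HB Require Import structures.
From mathcomp Require Import all_boot all_order all_algebra.
From mathcomp Require Import boolp classical_sets functions cardinality.
Set Implicit Arguments.
Unset Strict Implicit.
Unset Printing Implicit Defensive.
Local Open Scope classical_set_scope.
Local Open Scope card_scope.

Definition card_lt (T U : Type) (A : set T) (B : set U) : Prop :=
  A #<= B /\ ~ (B #<= A).

Definition is_succ_card (T U : Type) (A : set T) (B : set U) : Prop :=
  card_lt A B /\ forall (V : Type) (C : set V), card_lt A C -> B #<= C.

Definition is_omega2 (T : Type) : Prop :=
  exists T1 : Type, is_succ_card [set: nat] [set: T1] /\
                    is_succ_card [set: T1] [set: T].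

Definition cf_omega (T : Type) (A : set T) : Prop :=
  infinite_set A /\
  exists S : nat -> set T,
    A = \bigcup_n S n /\ forall n, card_lt (S n) A.

Definition I_f (U R : Type) (f : U -> R) (A : set U) : set R :=
  [set xi | (exists u, f u = xi) /\ exists! a, A a /\ f a = xi].

Definition is_system (TL TK TM U : Type) (F : set (set U)) : Prop :=
  [/\ F #= [set: TL],
      (forall A, F A -> A #= [set: TK]) &
      (forall A B, F A -> F B -> A <> B -> card_lt (A `&` B) [set: TM])].

Definition arrow (TL TK TM TR : Type) : Prop :=
  forall (U : Type) (F : set (set U)), is_system TL TK TM F ->
    exists f : U -> TR,
      forall A, F A -> card_lt ([set: TR] `\` I_f f A) [set: TR].

(* Main.v *)
(* Work with an indexed almost disjoint family (A i), i in J, and look for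
   T i <= A i of size at least omega_2 such that each A i meets the union of the
   other T j in at most omega_1 points; coloring each (trimmed) T i injectively
   with all of omega_2 and everything else with one color then proves the arrow.
   Such T is found by induction on the cardinal of J.  If |J| <= omega_2,
   well-order J in its initial order type and put T i = A i minus the earlier A j.
   Otherwise J is the union of an increasing chain of smaller "closed" sets G a,
   accompanied by sets of points Y a, with A i /\ Y a countable for i not in G a,
   and the induction hypothesis is applied to each difference
   G a \ U_(b < a) G b and to the traces of its A i on what is new in Y a.  The
   union of an increasing chain of countable sets has size at most omega_1, so the
   earlier Y b meet such an A i in at most omega_1 points.
   The hypothesis on cardinals of cofinality omega makes every uncountable N
   below lambda a countable union of sets K k with |K k|^omega <= N.  This suffices
   to close a set of N points in omega steps, since an infinite subset of A i
   determines i. *)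
Require Import Defs.
From Stdlib Require Import Wellfounded.
From HB Require Import structures.
From mathcomp Require Import all_boot all_order all_algebra.
From mathcomp Require Import boolp classical_sets functions cardinality wochoice.
Local Open Scope classical_set_scope.
Local Open Scope card_scope.

(** * Comparison of cardinals: injections as relations, minima, comparability *)

(** The relation need not be single-valued, since choice extracts a function from it. No inhabitant
    of [U] is required, so empty sets need no separate case. *)
Lemma card_leRP {T U : Type} {A : set T} {B : set U} :
  A #<= B <-> exists r : T -> U -> Prop,
    (forall x, A x -> exists2 y, B y & r x y) /\
    (forall x x' y, A x -> A x' -> r x y -> r x' y -> x = x').
Proof.
split=> [/card_leP[f]|[r [rAB rI]]].
  exists (fun x y => exists a : A, val a = x /\ val (f a) = y); split.
    move=> x Ax; exists (val (f (SigSub (mem_set Ax)))).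
      by apply: set_mem; apply: valP.
    by exists (SigSub (mem_set Ax)).
  move=> x x' y _ _ [a [<- <-]] [a' [<- /val_inj faa']].
  by congr val; symmetry; apply: (@inj _ _ setT f); rewrite ?inE.
have /choice[g gP] : forall a : A, exists y, B y /\ r (val a) y.
  by move=> a; have [y By rxy] := rAB _ (set_mem (valP a)); exists y.
pose h (a : A) : B := SigSub (mem_set (gP a).1).
apply/card_leP/injfunPex; exists h => // a a' _ _ /(congr1 val)/= gaa'.
apply: val_inj; apply: rI (set_mem (valP a)) (set_mem (valP a')) (gP a).2 _.
by rewrite gaa'; exact: (gP a').2.
Qed.

Lemma card_le_fun {T U : Type} {A : set T} {B : set U} (u : U) : A #<= B ->
  exists f : T -> U, (forall x, A x -> B (f x)) /\
    (forall x x', A x -> A x' -> f x = f x' -> x = x').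
Proof.
move=> /card_leRP[r [rAB rI]].
have /choice[f fP] : forall x, exists y, A x -> B y /\ r x y.
  move=> x; have [/rAB[y]|nAx] := pselect (A x); first by exists y.
  by exists u.
exists f; split=> [x /fP[]//|x x' Ax Ax' fE].
apply: (rI _ _ _ Ax Ax' (fP _ Ax).2).
by rewrite fE; exact: (fP _ Ax').2.
Qed.

Lemma fun_card_le {T U : Type} (A : set T) (B : set U) (f : T -> U) :
  (forall x, A x -> B (f x)) ->
  (forall x x', A x -> A x' -> f x = f x' -> x = x') -> A #<= B.
Proof.
move=> fAB fI; apply/card_leRP; exists (fun x y => y = f x); split.
  by move=> x Ax; exists (f x); first exact: fAB.
by move=> x x' y Ax Ax' -> /fI; apply.
Qed.

Lemma card_min {T : Type} (S : set (set T)) : S !=set0 ->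
  exists2 B, S B & forall C, S C -> B #<= C.
Proof.
move=> [B0 SB0].
(* A maximal family of pairwise everywhere distinct choice functions on S must
   exhaust some member of S. *)
pose good (P : set (set T -> T)) :=
  (forall p B, P p -> S B -> B (p B)) /\
  (forall p q B, P p -> P q -> S B -> p B = q B -> p = q).
have [|P [[PS PI] Pmax]] := @Zorn_bigcup _ good.
  move=> F Fgood Ftot; split=> [p B [P FP Pp]|p q B [P FP Pp] [Q FQ Qq]].
    exact: (proj1 (Fgood _ FP) p B).
  have [/(_ _ Pp) Qp|/(_ _ Qq) Pq] := Ftot _ _ FP FQ;
    [exact: (proj2 (Fgood _ FQ) p q B)|exact: (proj2 (Fgood _ FP) p q B)].
have [[B SB Bsurj]|noB] :=
    pselect (exists2 B, S B & forall x, B x -> exists2 p, P p & p B = x).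
  exists B => // C SC; apply/card_leRP.
  exists (fun x y => exists2 p, P p & p B = x /\ p C = y); split.
    by move=> x /Bsurj[p Pp <-]; exists (p C); [exact: (PS p C)|exists p].
  move=> x x' y _ _ [p Pp [<- <-]] [q Pq [<- qC]].
  by rewrite (PI p q C).
(* If no member of [S] is exhausted, a fresh value picked in each member gives a choice function
   that enlarges [P]. *)
have ex B : S B -> exists x, B x /\ forall p, P p -> p B <> x.
  move=> SB; apply: contrapT => nex; apply: noB; exists B => // x Bx.
  apply: contrapT => nx; apply: nex; exists x; split=> // p Pp pB.
  by apply: nx; exists p.
have [x0 _] := ex _ SB0.
have /choice[p pP] : forall B, exists x, S B ->
    B x /\ forall p, P p -> p B <> x.
  move=> B; have [/ex[x]|nS] := pselect (S B); first by exists x.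
  by exists x0.
exfalso; apply: (Pmax (P `|` [set p])).
  split=> [q Pq|/(_ p (or_intror erefl)) Pp]; first by left.
  by have [_ /(_ p Pp)] := pP _ SB0.
split=> [q B [Pq|->] SB|q q' B [Pq|->] [Pq'|->] SB //].
- exact: (PS q B).
- by have [] := pP _ SB.
- exact: (PI q q' B).
- by have [_ /(_ q Pq)] := pP _ SB.
- by move/esym; have [_ /(_ q' Pq')] := pP _ SB.
Qed.

Lemma card_image_inl {T U : Type} (A : set T) : (inl @` A : set (T + U)) #= A.
Proof. by apply: inj_card_eq => x y _ _ []. Qed.

Lemma card_image_inr {T U : Type} (A : set T) : (inr @` A : set (U + T)) #= A.
Proof. by apply: inj_card_eq => x y _ _ []. Qed.

Lemma card_le_total {T U : Type} (A : set T) (B : set U) :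
  A #<= B \/ B #<= A.
Proof.
have [|C] := @card_min (T + U) [set inl @` A; inr @` B].
  by exists (inl @` A); left.
case=> -> h; [left|right].
- have := h _ (or_intror erefl).
  by rewrite (card_le_eql (card_image_inl A)) (card_le_eqr (card_image_inr B)).
- have := h _ (or_introl erefl).
  by rewrite (card_le_eqr (card_image_inl A)) (card_le_eql (card_image_inr B)).
Qed.

Lemma card_ltNge {T U : Type} {A : set T} {B : set U} :
  card_lt A B <-> ~ (B #<= A).
Proof.
split=> [[]//|nBA]; split=> //.
by have [] := card_le_total A B.
Qed.

Lemma card_le_lt_trans {T U V : Type} {A : set T} {B : set U} {C : set V} :
  A #<= B -> card_lt B C -> card_lt A C.
Proof.
move=> AB [BC nCB]; apply/card_ltNge => CA; apply: nCB.
exact: card_le_trans CA AB.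
Qed.

Lemma card_lt_le_trans {T U V : Type} {A : set T} {B : set U} {C : set V} :
  card_lt A B -> B #<= C -> card_lt A C.
Proof.
move=> [AB nBA] BC; apply/card_ltNge => CA; apply: nBA.
exact: card_le_trans BC CA.
Qed.

Lemma card_ind {T : Type} (P : set T -> Prop) :
  (forall J, (forall J', card_lt J' J -> P J') -> P J) -> forall J, P J.
Proof.
move=> IH J; apply: contrapT => nPJ.
have [|B nPB Bmin] := @card_min T [set J | ~ P J]; first by exists J.
apply: nPB; apply: IH => J' [J'B nBJ']; apply: contrapT => /Bmin.
exact: nBJ'.
Qed.

(** * Well-orders of initial type and recursion with choice *)

Definition initial_wo {T : Type} (J : set T) (R : T -> T -> Prop) :=
  [/\ well_founded R, (forall x y z, R x y -> R y z -> R x z),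
      (forall x y, J x -> J y -> x = y \/ R x y \/ R y x) &
      (forall x, J x -> card_lt [set y | J y /\ R y x] J)].

Lemma wf_min {T : Type} (R : T -> T -> Prop) (A : set T) :
  well_founded R -> A !=set0 -> exists2 x, A x & forall y, A y -> ~ R y x.
Proof.
move=> Rwf [x0 Ax0]; apply: contrapT => nmin.
suff: forall x, ~ A x by move/(_ x0).
apply: (well_founded_ind Rwf) => x IH Ax; apply: nmin; exists x => // y Ay Ryx.
exact: IH Ryx Ay.
Qed.

Lemma well_order_exists (T : Type) : exists R : T -> T -> Prop,
  [/\ well_founded R, (forall x y z, R x y -> R y z -> R x z) &
      (forall x y, x = y \/ R x y \/ R y x)].
Proof.
elim/Peq: T => T.
have [R Rwo] := @well_ordering_principle T.
have Rmin (A : set T) : A !=set0 -> exists2 x, A x & forall y, A y -> R x y.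
  move=> [a Aa]; have [|x [[/asboolP Ax xmin] _]] := Rwo (fun x => `[<A x>]).
    by exists a; apply/asboolP.
  by exists x => // y Ay; apply: xmin; apply/asboolP.
have Rtot x y : R x y \/ R y x.
  by have [|z [->|->] zmin] := Rmin [set x; y]; first (by exists x; left);
    [left; apply: zmin; right|right; apply: zmin; left].
have Ranti x y : R x y -> R y x -> x = y.
  (* Both [x] and [y] are least in the pair, so uniqueness of the least element identifies them. *)
  move=> Rxy Ryx; have [|z [_ zU]] := Rwo (pred2 x y).
    by exists x; rewrite inE eqxx.
  have Rxx w : R w w by have [] := Rtot w w.
  have zx : z = x.
    by apply: zU; split=> [|w]; rewrite inE ?eqxx // => /orP[]/eqP->.
  rewrite -zx; apply: zU; split=> [|w]; rewrite inE ?eqxx ?orbT //.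
  by move=> /orP[]/eqP->.
(* By totality and antisymmetry this is the strict part of [R]. *)
exists (fun x y => ~ R y x); split.
- move=> x; apply: contrapT => nAx.
  have [|y nAy ymin] := Rmin [set x | ~ Acc (fun x y => ~ R y x) x].
    by exists x.
  apply: nAy; constructor => z nRyz; apply: contrapT => /ymin.
  exact: nRyz.
- move=> x y z nRyx nRzy Rzx.
  have [|w + wmin] := Rmin [set x; y; z]; first by exists x; left; left.
  case=> [[]|] we; rewrite {w}we in wmin.
  + have xz : x = z by apply: Ranti => //; apply: wmin; right.
    by apply: nRzy; rewrite -xz; apply: wmin; left; right.
  + by apply: nRyx; apply: wmin; left; left.
  + by apply: nRzy; apply: wmin; left; right.
- move=> x y; have [Rxy|nRxy] := pselect (R x y); last by right; right.
  have [Ryx|nRyx] := pselect (R y x); last by right; left.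
  by left; exact: Ranti.
Qed.

(** If some segment of a well-order is as large as [J], let [b] be the least point with such a
    segment and pull the order back along an injection of [J] into it. A large segment of the new
    order would embed below a point preceding [b]. *)
Lemma initial_wo_exists {T : Type} (J : set T) : exists R, initial_wo J R.
Proof.
have [R [Rwf Rtr Rtot]] := well_order_exists T.
pose seg a := [set y | J y /\ R y a].
have [[a [Ja Jseg]]|nex] := pselect (exists a, J a /\ J #<= seg a); last first.
  exists R; split=> // x Jx.
  by apply/card_ltNge => Jle; apply: nex; exists x.
have [|b [Jb Jsegb] bmin] := wf_min R [set a | J a /\ J #<= seg a] Rwf.
  by exists a.
have [f [fseg fI]] := card_le_fun b Jsegb.
exists (fun x y => [/\ J x, J y & R (f x) (f y)]); split.
- have : well_founded (fun x y => R (f x) (f y)).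
    exact: wf_inverse_image.
  by apply: wf_incl => x y [].
- by move=> x y z [Jx _ Rxy] [_ Jz Ryz]; split=> //; exact: Rtr Rxy Ryz.
- move=> x y Jx Jy; have [/fI->//|[Rxy|Ryx]] := Rtot (f x) (f y); first by left.
  + by right; left.
  + by right; right.
- move=> x Jx; apply/card_ltNge => Jle; have [Jfx Rfxb] := fseg _ Jx.
  apply: (bmin (f x) _ Rfxb); split=> //; apply: card_le_trans Jle _.
  apply: (fun_card_le _ _ f) => [y [Jy [_ _ Ryx]]|y z [Jy _] [Jz _]].
    by split=> //; have [] := fseg _ Jy.
  exact: fI.
Qed.

Lemma partial_choice {T U : Type} (u : U) (Q : T -> U -> Prop) :
  exists f : T -> U, forall x, (exists y, Q x y) -> Q x (f x).
Proof.
suff /choice[f fQ] : forall x, exists y, (exists z, Q x z) -> Q x y by exists f.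
move=> x; have [[y Qxy]|nex] := pselect (exists y, Q x y).
  by exists y.
by exists u => /nex.
Qed.

(** The condition on the value at [a] sees only earlier values, so these may be extended by the
    default [v0]. Solvability is demanded pointwise for the finished [h], so it can be proved
    afterwards by induction, from the conditions holding at earlier points. *)
Lemma wf_rec_choice {T V : Type} (R : T -> T -> Prop) (v0 : V)
    (Q : T -> (T -> V) -> V -> Prop) : well_founded R ->
  (forall a g g' v, (forall b, R b a -> g b = g' b) -> Q a g v -> Q a g' v) ->
  exists h : T -> V, forall a, (exists v, Q a h v) -> Q a h (h a).
Proof.
move=> Rwf Qloc.
have [F FP] := partial_choice v0 (fun x : T * (T -> V) => Q x.1 x.2).
pose ext a (g : forall b, R b a -> V) b :=
  if pselect (R b a) is left p then g b p else v0.
pose h := Fix Rwf (fun=> V) (fun a g => F (a, ext a g)).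
have hE a : h a = F (a, ext a (fun b _ => h b)).
  rewrite /h Fix_eq // => x f g fg; congr (F (_, _)); apply/funext => b.
  by rewrite /ext; case: pselect.
have extE a b : R b a -> h b = ext a (fun b _ => h b) b.
  by rewrite /ext; case: pselect.
exists h => a [v Qv]; rewrite [X in Q _ _ X]hE.
apply: (Qloc _ (ext a (fun b _ => h b))); first by move=> b /extE.
by apply: (FP (a, _)); exists v; apply: Qloc Qv => b /extE.
Qed.


(** * Arithmetic of infinite cardinals *)

(** Send each [p] recursively to a point of [X] not taken by its predecessors; they are too few to
    exhaust [X]. *)
Lemma wf_card_le {T U : Type} (P : set U) (X : set T) (R : U -> U -> Prop) :
  well_founded R -> (forall x y, P x -> P y -> x = y \/ R x y \/ R y x) ->
  (forall x, P x -> card_lt [set y | P y /\ R y x] X) -> P #<= X.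
Proof.
move=> Rwf Rtot Rseg.
have [[p0 Pp0]|P0] := pselect (P !=set0); last first.
  suff -> : P = set0 by exact: card_ge0.
  by rewrite -subset0 => p Pp; apply: P0; exists p.
have [x0 Xx0] : X !=set0.
  apply: contrapT => X0; have [_] := Rseg _ Pp0; apply.
  suff -> : X = set0 by exact: card_ge0.
  by rewrite -subset0 => x Xx; apply: X0; exists x.
pose Q p (g : U -> T) x := X x /\ forall q, P q -> R q p -> g q <> x.
have [|h hQ] := wf_rec_choice R x0 Q Rwf.
  move=> a g g' v gg' [Xv gv]; split=> // q Pq Rqa; rewrite -gg' //.
  exact: gv.
have {}hQ p : P p -> Q p h (h p).
  move=> Pp; apply: hQ; apply: contrapT => nex.
  have [_] := Rseg _ Pp; apply; apply: card_le_trans (card_image_le h _).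
  apply: subset_card_le => x Xx; apply: contrapT => nx; apply: nex.
  exists x; split=> // q Pq Rqp hq; apply: nx; exists q => //.
apply: (fun_card_le _ _ h) => [p /hQ[]//|p q Pp Pq hpq].
have [//|[Rpq|Rqp]] := Rtot _ _ Pp Pq.
- by have [_ /(_ _ Pp Rpq)] := hQ _ Pq.
- by have [_ /(_ _ Pq Rqp) []] := hQ _ Pp.
Qed.

Lemma card_setU1_le {T : Type} (A : set T) (a : T) : infinite_set A ->
  a |` A #<= A.
Proof.
move=> /infiniteP Ainf; have [f [fA fI]] := card_le_fun a Ainf.
have {}fI m n : f m = f n -> m = n by exact: fI.
apply/card_leRP; exists (fun x y => (x = a /\ y = f 0%N) \/
  (x <> a /\ ((exists n, x = f n /\ y = f n.+1) \/
               ((forall n, x <> f n) /\ y = x)))); split.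
  move=> x Ax; have [->|xa] := pselect (x = a).
    by exists (f 0%N); [exact: fA|left].
  have [[n xfn]|nex] := pselect (exists n, x = f n).
    by exists (f n.+1); [exact: fA|right; split=> //; left; exists n].
  exists x; first by case: Ax => // /xa.
  by right; split=> //; right; split=> // n xfn; apply: nex; exists n.
move=> x x' y _ _ [[-> ->]|[xa [[n [-> ->]]|[xf ->]]]].
- by case=> [[->]//|[_ [[n [_ /fI]]//|[xf fx]]]]; case: (xf 0%N).
- by case=> [[_ /fI]//|[_ [[m [-> /fI[->]]]//|[xf fx]]]]; case: (xf n.+1).
- by case=> [[_ /xf]//|[_ [[m [_ /xf]]//|[]]]].
Qed.

Lemma card_lt_finite {T U : Type} (A : set T) (B : set U) :
  finite_set A -> infinite_set B -> card_lt A B.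
Proof.
move=> finA infB; apply/card_ltNge => BA; apply: infB.
exact: card_le_finite BA finA.
Qed.

Lemma infinite_setX_le {T : Type} (X : set T) : infinite_set X ->
  X `*` X #<= X.
Proof.
move: X; apply: card_ind => X IH Xinf.
have [R [Rwf Rtr Rtot Rseg]] := initial_wo_exists X.
have [R' [Rwf' _ Rtot']] := well_order_exists (T * T).
pose J m := [set z | X z /\ (z = m \/ R z m)].
(* The pairs preceding [p] will lie in the square of the closed segment at the maximum of [p]; the
   induction hypothesis keeps that square below [X]. *)
have Jlt m : X m -> card_lt (J m `*` J m) X.
  move=> Xm; have [Jfin|Jinf] := pselect (finite_set (J m)).
    by apply: card_lt_finite => //; apply: finite_setX.
  have JX : card_lt (J m) X.
    apply: (card_le_lt_trans (B := [set z | X z /\ R z m])); last exact: Rseg.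
    have JE : J m `<=` m |` [set z | X z /\ R z m].
      by move=> z [Xz [->|Rzm]]; [left|right].
    apply: card_le_trans (subset_card_le JE) (card_setU1_le _ _ _) => fin.
    by apply: Jinf; apply: sub_finite_set JE _; rewrite finite_setU; split.
  exact: card_le_lt_trans (IH _ JX Jinf) JX.
(* Goedel's well-order: by maximum first, then by an arbitrary well-order. *)
pose mx (p : T * T) := if pselect (R p.1 p.2) then p.2 else p.1.
have mxX p : (X `*` X) p -> X (mx p) by move=> [? ?]; rewrite /mx; case: pselect.
have mxJ p : (X `*` X) p -> (J (mx p) `*` J (mx p)) p.
  case: p => x y [/= Xx Xy]; rewrite /mx /=; case: pselect => /= [Rxy|nRxy].
    by split; split=> //; [right|left].
  split; split=> //=; first by left.
  by have [->|[//|]] := Rtot _ _ Xx Xy; [left|right].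
pose S p q := R (mx p) (mx q) \/ (mx p = mx q /\ R' p q).
apply: (wf_card_le _ _ S).
- suff H m p : mx p = m -> Acc S p by move=> p; exact: (H (mx p)).
  elim/(well_founded_ind Rwf): m p => m IHm p.
  elim/(well_founded_ind Rwf'): p => p IHp pm; constructor => q [Rqp|[qp]].
    by apply: IHm (erefl _); rewrite -pm.
  by move/IHp; apply; rewrite qp.
- move=> p q Xp Xq.
  have [E|[Rpq|Rqp]] := Rtot _ _ (mxX _ Xp) (mxX _ Xq).
  + have [|[R'pq|R'qp]] := Rtot' p q; first by left.
      by right; left; right.
    by right; right; right.
  + by right; left; left.
  + by right; right; left.
- move=> p Xp; apply: card_le_lt_trans _ (Jlt _ (mxX _ Xp)).
  apply: subset_card_le => q [Xq Sqp].
  have [[X1 q1] [X2 q2]] := mxJ _ Xq.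
  case: Sqp => [Rqp|[<- _]]; last by [].
  split; split=> //; right.
    by case: q1 => [->//|Rq]; exact: Rtr Rq Rqp.
  by case: q2 => [->//|Rq]; exact: Rtr Rq Rqp.
Qed.

Lemma bigcup_card_le {I T V : Type} (D : set I) (F : I -> set T) (N : set V) :
  infinite_set N -> D #<= N -> (forall i, D i -> F i #<= N) ->
  \bigcup_(i in D) F i #<= N.
Proof.
move=> Ninf DN FN; have [v Nv] := infinite_setN0 Ninf.
apply: card_le_trans (infinite_setX_le _ Ninf).
have [e [eN eI]] := card_le_fun v DN.
have [h hP] := partial_choice (fun _ : T => v) (fun i (h : T -> V) =>
  D i /\ (forall x, F i x -> N (h x)) /\
  (forall x x', F i x -> F i x' -> h x = h x' -> x = x')).
have {}hP i : D i -> (forall x, F i x -> N (h i x)) /\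
  (forall x x', F i x -> F i x' -> h i x = h i x' -> x = x').
  move=> Di; have [g gP] := card_le_fun v (FN _ Di).
  by have [] := hP i (ex_intro _ g (conj Di gP)).
apply/card_leRP.
exists (fun x y => exists2 i, D i & F i x /\ y = (e i, h i x)); split.
  move=> x [i Di Fix]; exists (e i, h i x); last by exists i.
  by split; [exact: eN|exact: (hP _ Di).1].
move=> x x' _ _ _ [i Di [Fx ->]] [j Dj [Fx' [/eI ij hx]]].
have {}ij := ij Di Dj; rewrite -{}ij in Dj Fx' hx.
exact: (hP _ Di).2.
Qed.

Lemma setU_card_le {T V : Type} (A B : set T) (N : set V) :
  infinite_set N -> A #<= N -> B #<= N -> A `|` B #<= N.
Proof.
move=> Ninf AN BN; rewrite -bigcup2E; apply: bigcup_card_le => //.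
  by apply: card_le_trans (card_leT _) _; apply/infiniteP.
by move=> [|[|n]] _ //=; exact: card_ge0.
Qed.

Lemma card_leD {T : Type} (A B : set T) : infinite_set A -> card_lt B A ->
  A #<= A `\` B.
Proof.
move=> Ainf BA; apply: contrapT => /card_ltNge DA.
have AE : A `<=` (A `\` B) `|` B.
  by move=> x Ax; have [Bx|nBx] := pselect (B x); [right|left].
have absurd (M : set T) : A `\` B #<= M -> B #<= M -> card_lt M A -> False.
  move=> DM BM [_]; apply; have [Mfin|Minf] := pselect (finite_set M).
    exfalso; apply: Ainf; apply: sub_finite_set AE _.
    by rewrite finite_setU; split; apply: card_le_finite Mfin.
  by apply: card_le_trans (subset_card_le AE) _; exact: setU_card_le.
have [DB|BD] := card_le_total (A `\` B) B.
- exact: (absurd B).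
- exact: (absurd (A `\` B)).
Qed.

(** * Countable powers and cofinality omega *)

Definition pow {T : Type} (A : set T) : set (nat -> T) :=
  [set g | forall n, A (g n)].

Lemma pow_card_le {T U : Type} (A : set T) (B : set U) :
  A #<= B -> pow A #<= pow B.
Proof.
move=> /card_leRP[r [rA rI]]; apply/card_leRP.
exists (fun g h => forall n, r (g n) (h n)); split.
  move=> g Ag; suff /choice[h hP] : forall n, exists y, B y /\ r (g n) y.
    by exists h => n; have [] := hP n.
  by move=> n; have [y] := rA _ (Ag n); exists y.
move=> g g' h Ag Ag' rg rg'; apply/funext => n.
exact: (rI _ _ _ (Ag n) (Ag' n) (rg n) (rg' n)).
Qed.

Lemma finite_pow_card_le {T : Type} (A : set T) : finite_set A ->
  pow A #<= [set: nat -> nat].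
Proof.
move=> Afin; have -> : [set: nat -> nat] = pow [set: nat] by apply/seteqP.
exact/pow_card_le/finite_set_countable.
Qed.

(** Quantifying over all [M] above [V] expresses a bound by the successor of [V]. If [V] does not
    have cofinality omega, every sequence is bounded in an initial well-order, so [pow V] is the
    union of the powers of the segments, each at most [V] by induction. *)
Lemma pow_card_le_succ {T : Type} :
  (forall V M : set T, card_lt V [set: T] -> cf_omega V -> card_lt V M ->
    pow V #<= M) ->
  (forall M : set T, card_lt [set: nat] M -> [set: nat -> nat] #<= M) ->
  forall V : set T, infinite_set V -> card_lt V [set: T] ->
    (forall M : set T, card_lt V M -> pow V #<= M) /\
    (~ cf_omega V -> pow V #<= V).
Proof.
move=> Hcof Hnat; apply: card_ind => V IH Vinf VT.
suff powV : ~ cf_omega V -> pow V #<= V.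
  split=> // M VM; have [Vcof|/powV le] := pselect (cf_omega V).
    exact: Hcof.
  by apply: card_le_trans le _; case: VM.
move=> ncof; have [R [Rwf _ Rtot Rseg]] := initial_wo_exists V.
pose seg a := [set y | V y /\ R y a].
have natV : card_lt [set: nat] V.
  apply/card_ltNge => Vnat; apply: ncof; split=> //.
  have [f [_ fI]] := card_le_fun 0%N Vnat.
  exists (fun n => [set x | V x /\ f x = n]); split.
    by apply/seteqP; split=> [x Vx|x [n _ []//]]; exists (f x).
  move=> n; apply: card_lt_finite => //.
  apply: (card_le_finite (B := [set n])) (finite_set1 n).
  apply: (fun_card_le _ _ f) => [x []//|x y [Vx xn] [Vy yn] _].
  by apply: fI => //; rewrite xn.
have powE : pow V `<=` \bigcup_(a in V) pow (seg a).
  (* An unbounded sequence would write [V] as a countable union of closed segments, all smaller than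
     [V]. *)
  move=> g Vg; apply: contrapT => nbd; apply: ncof; split=> //.
  exists (fun n => [set x | V x /\ (x = g n \/ R x (g n))]); split.
    apply/seteqP; split=> [x Vx|x [n _ []//]].
    have [n ngx] : exists n, ~ R (g n) x.
      apply: contrapT => nex; apply: nbd; exists x => // n; split=> //.
      by apply: contrapT => nR; apply: nex; exists n.
    exists n => //; split=> //.
    by have [|[]] := Rtot _ _ Vx (Vg n); [left|right|].
  move=> n; have [fin|inf] := pselect (finite_set (seg (g n))).
    apply: card_lt_finite => //.
    apply: (sub_finite_set (B := g n |` seg (g n))).
      by move=> x [Vx [->|Rx]]; [left|right].
    by rewrite finite_setU; split.
  apply: card_le_lt_trans (Rseg _ (Vg n)).
  apply: card_le_trans (card_setU1_le _ (g n) inf).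
  by apply: subset_card_le => x [Vx [->|Rx]]; [left|right].
apply: card_le_trans (subset_card_le powE) _.
apply: bigcup_card_le => // a Va; have segV := Rseg _ Va.
have [fin|inf] := pselect (finite_set (seg a)).
  exact: card_le_trans (finite_pow_card_le _ fin) (Hnat _ natV).
exact: (IH _ segV inf (card_lt_le_trans segV (card_leT _))).1.
Qed.

(** A substitute for [pow V #<= V] that is also available at cofinality omega. *)
Definition nice {T : Type} (V : set T) := exists K : nat -> set T,
  V `<=` \bigcup_k K k /\ forall k, pow (K k) #<= V.

(** At cofinality omega the smaller sets [S k] witnessing it serve as [K]; otherwise [K] is
    constantly [V]. *)
Lemma uncountable_nice {T : Type} :
  (forall V M : set T, card_lt V [set: T] -> cf_omega V -> card_lt V M ->
    pow V #<= M) ->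
  (forall M : set T, card_lt [set: nat] M -> [set: nat -> nat] #<= M) ->
  forall V : set T, card_lt [set: nat] V -> card_lt V [set: T] -> nice V.
Proof.
move=> Hcof Hnat V natV VT; have Vinf : infinite_set V.
  by apply/infiniteP; case: natV.
have H := pow_card_le_succ Hcof Hnat.
have [[_ [S [VE SV]]]|ncof] := pselect (cf_omega V); last first.
  exists (fun=> V); split=> [x Vx|_]; first by exists 0%N.
  exact: (H _ Vinf VT).2.
exists S; split=> [|k]; first by rewrite -VE.
have [fin|inf] := pselect (finite_set (S k)).
  exact: card_le_trans (finite_pow_card_le _ fin) (Hnat _ natV).
exact: (H _ inf (card_lt_le_trans (SV k) (card_leT _))).1.
Qed.

(** * Almost disjoint families: counting large traces and closing off *)

(** An injective sequence in [A i] and [B] determines [i], because distinct members share only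
    finitely many points. *)
Lemma meet_infinite_card_le {I X : Type} (A : I -> set X) (B : set X) :
  (forall i j, i <> j -> finite_set (A i `&` A j)) ->
  [set i | infinite_set (A i `&` B)] #<= pow B.
Proof.
move=> Aad; apply/card_leRP.
exists (fun i g => (forall m n : nat, g m = g n -> m = n) /\
  forall n, (A i `&` B) (g n)); split.
  move=> i /= Ainf; have [x _] := infinite_setN0 Ainf.
  move/infiniteP: Ainf => /(card_le_fun x)[g [gA gI]].
  exists g; first by move=> n; have [] := gA n Logic.I.
  by split=> [m n|n]; [exact: gI|exact: gA].
move=> i j g _ _ [gI gi] [_ gj]; apply: contrapT => /Aad; apply/infiniteP.
apply: (fun_card_le _ _ g) => [n _|m n _ _]; last exact: gI.
by have [] := gi n; have [] := gj n.
Qed.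

(** The sets [K k] are pulled back to pieces [Yk k] of [Y]. An uncountable trace on [Y] is infinite
    on some piece, and each piece admits at most [pow (K k)] such indices. *)
Lemma meet_uncountable_card_le {T I X : Type} (N : set T) (A : I -> set X)
    (Y : set X) :
  infinite_set N -> nice N ->
  (forall i j, i <> j -> finite_set (A i `&` A j)) -> Y #<= N ->
  [set i | ~ countable (A i `&` Y)] #<= N.
Proof.
move=> Ninf [K [NK powK]] Aad YN; have [v _] := infinite_setN0 Ninf.
have [f [fN fI]] := card_le_fun v YN.
pose Yk k := [set x | Y x /\ K k (f x)].
apply: (card_le_trans (B := \bigcup_k [set i | infinite_set (A i `&` Yk k)])).
  apply: subset_card_le => i nc; apply: contrapT => nex; apply: nc.
  apply: (sub_countable (B := \bigcup_k (A i `&` Yk k))).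
    apply: subset_card_le => x [Ax Yx]; have [k _ Kk] := NK _ (fN _ Yx).
    by exists k.
  apply: bigcup_countable => // k _; apply: finite_set_countable.
  by apply: contrapT => inf; apply: nex; exists k.
apply: bigcup_card_le => //; first exact/infiniteP.
move=> k _; apply: card_le_trans (meet_infinite_card_le _ _ Aad) _.
apply: card_le_trans (powK k); apply: pow_card_le.
apply: (fun_card_le _ _ f) => [x []//|x y [Yx _] [Yy _]]; exact: fI.
Qed.

(* The analogue of an elementary submodel of cardinality [N]. *)
Lemma closure_exists {T I X : Type} (N : set T) (A S : I -> set X)
    (G0 : set I) (Y0 : set X) :
  infinite_set N -> nice N ->
  (forall i j, i <> j -> finite_set (A i `&` A j)) ->
  (forall i, S i #<= N) -> G0 #<= N -> Y0 #<= N ->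
  exists (G : set I) (Y : set X), [/\ G0 `<=` G, Y0 `<=` Y, G #<= N, Y #<= N &
    (forall i, G i -> S i `<=` Y) /\ (forall i, ~ G i -> countable (A i `&` Y))].
Proof.
move=> Ninf Nnice Aad SN G0N Y0N.
pose E (Y : set X) := [set i | ~ countable (A i `&` Y)].
(* Each stage adds [S i] for the indices whose trace on the previous stage is uncountable. An index
   outside the final [G] has a countable trace on every stage, hence on their union. *)
pose Yn := fix Yn n := if n is m.+1 then Yn m `|` \bigcup_(i in E (Yn m)) S i
  else Y0 `|` \bigcup_(i in G0) S i.
have YnN n : Yn n #<= N.
  elim: n => [|n IH] /=; apply: setU_card_le => //; apply: bigcup_card_le => //.
  exact: meet_uncountable_card_le.
exists (G0 `|` \bigcup_n E (Yn n)), (\bigcup_n Yn n); split.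
- by move=> i; left.
- by move=> x Y0x; exists 0%N => //; left.
- apply: setU_card_le => //; apply: bigcup_card_le => //; first exact/infiniteP.
  by move=> n _; exact: meet_uncountable_card_le.
- by apply: bigcup_card_le => //; first exact/infiniteP.
split=> [i [G0i|[n _ En]] x Sx|i nG].
- by exists 0%N => //; right; exists i.
- by exists n.+1 => //; right; exists i.
rewrite setI_bigcupr; apply: bigcup_countable => // n _.
by apply: contrapT => nc; apply: nG; right; exists n.
Qed.

(** * Chains of countable sets and the construction of the separating sets *)

Lemma succ_card_le {T U V : Type} {A : set T} {B : set U} {C : set V} :
  is_succ_card A B -> card_lt C B -> C #<= A.
Proof.
move=> [_ Bmin] CB; apply: contrapT => /card_ltNge/Bmin.
by case: CB.
Qed.

(** Suppose the union exceeds [W] and pick [W] many points [e w] of it, with [e w] in [C (b w)]. No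
    single [C a] holds them all, as [W] is uncountable, so the [C (b w)] are cofinal in the chain
    and their union is at most [W] after all. *)
Lemma chain_bigcup_card_le {W J X : Type} (R : J -> J -> Prop) (D : set J)
    (C : J -> set X) : card_lt [set: nat] [set: W] ->
  (forall a b, D a -> D b -> a = b \/ R a b \/ R b a) ->
  (forall a b, D a -> D b -> R a b -> C a `<=` C b) ->
  (forall a, D a -> countable (C a)) ->
  \bigcup_(a in D) C a #<= [set: W].
Proof.
move=> natW Rtot Cmono Cctbl; apply: contrapT => /card_ltNge WC.
have [x0 _] : \bigcup_(a in D) C a !=set0.
  apply: contrapT => C0; case: WC => _; apply.
  suff -> : \bigcup_(a in D) C a = set0 by exact: card_ge0.
  by rewrite -subset0 => x Cx; apply: C0; exists x.
have [e [eC eI]] := card_le_fun x0 WC.1.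
have /choice[b bP] : forall w, exists a, D a /\ C a (e w).
  by move=> w; have [a Da Ca] := eC w Logic.I; exists a.
have [[a [Da Ca]]|nex] := pselect (exists a, D a /\ forall w, C a (e w)).
  case: natW => _; apply; apply: card_le_trans (Cctbl _ Da).
  by apply: (fun_card_le _ _ e) => [w _|w w' _ _]; [exact: Ca|exact: eI].
case: WC => _; apply.
apply: (card_le_trans (B := \bigcup_(w in [set: W]) C (b w))).
  apply: subset_card_le => x [a Da Cx].
  have [w nCw] : exists w, ~ C a (e w).
    apply: contrapT => nw; apply: nex; exists a; split=> // w.
    by apply: contrapT => nC; apply: nw; exists w.
  have [Db Cb] := bP w; exists w => //.
  have [<-//|[Rab|Rba]] := Rtot _ _ Da Db; first exact: (Cmono a).
  by case: nCw; apply: Cmono Rba _ Cb.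
apply: bigcup_card_le => //; first by apply/infiniteP; case: natW.
move=> w _; apply: card_le_trans (Cctbl _ (bP w).1) _; by case: natW.
Qed.

(** The [T i] may overlap; the overlaps are small enough to be trimmed when coloring. *)
Definition separated (W1 W2 : Type) {I X : Type} (J : set I)
    (A T : I -> set X) :=
  forall i, J i -> [/\ T i `<=` A i, [set: W2] #<= T i &
    A i `&` \bigcup_(j in J `\ i) T j #<= [set: W1]].

Lemma separated_base (W1 W2 : Type) {I X : Type} (J : set I) (A : I -> set X) :
  is_succ_card [set: nat] [set: W1] -> is_succ_card [set: W1] [set: W2] ->
  (forall i j, i <> j -> finite_set (A i `&` A j)) ->
  (forall i, J i -> [set: W2] #<= A i) -> J #<= [set: W2] ->
  exists T, separated W1 W2 J A T.
Proof.
move=> [[natW1 _] _] W12 Aad W2A JW2.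
have W1inf : infinite_set [set: W1] by apply/infiniteP.
have [R [Rwf Rtr Rtot Rseg]] := initial_wo_exists J.
pose seg a := [set y | J y /\ R y a].
pose B i := A i `&` \bigcup_(j in seg i) A j.
have BW1 i : J i -> B i #<= [set: W1].
  move=> Ji; rewrite /B setI_bigcupr; apply: bigcup_card_le => //.
    apply: succ_card_le W12 _; exact: card_lt_le_trans (Rseg _ Ji) JW2.
  move=> j [_ Rji]; apply: card_le_trans natW1; apply: finite_set_countable.
  apply: Aad => ij; rewrite ij in Rji.
  by have [x /= -> /(_ _ erefl)] := wf_min R [set j] Rwf (ex_intro _ j erefl).
exists (fun i => A i `\` B i) => i Ji; split; first by move=> x [].
  apply: card_le_trans (W2A _ Ji) _; apply: card_leD.
    apply/infiniteP; apply: card_le_trans natW1 _.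
    by case: W12 => -[W12 _] _; apply: card_le_trans W12 (W2A _ Ji).
  apply: card_le_lt_trans (BW1 _ Ji) _.
  by case: W12 => W12 _; apply: card_lt_le_trans W12 (W2A _ Ji).
apply: card_le_trans (BW1 _ Ji); apply: subset_card_le.
move=> x [Ax [j [Jj /= ji] [Ajx nBx]]]; split=> //.
(* A point shared with an earlier [A j] is in [B i] by definition; for a later [j] it is in [B j],
   which [T j] omits. *)
have [//|[Rji|Rij]] := Rtot _ _ Jj Ji; first by exists j.
by case: nBx; split=> //; exists i.
Qed.

Lemma card_le_subset {T U : Type} (A : set T) (B : set U) : A #<= B ->
  exists2 B', B' `<=` B & B' #= A.
Proof.
move=> AB; have [[u Bu]|B0] := pselect (B !=set0).
  have [f [fB fI]] := card_le_fun u AB; exists (f @` A).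
    by move=> _ [x Ax <-]; exact: fB.
  by apply: inj_card_eq => x y /set_mem Ax /set_mem Ay; exact: fI.
have BE : B = set0 by rewrite -subset0 => u Bu; apply: B0; exists u.
exists set0 => //; rewrite card_eq_le card_ge0 /=.
by rewrite BE in AB.
Qed.

(** The induction replaces the [A i] by traces, which either keep size at least [K] or are only
    known to be as large as their index set. The final disjunction of the hypothesis on [A] is the
    form that survives this passage. *)
Lemma separated_exists (W1 W2 : Type) {I X L : Type} (K : set L) :
  is_succ_card [set: nat] [set: W1] -> is_succ_card [set: W1] [set: W2] ->
  (forall N : set I, [set: W2] #<= N -> card_lt N [set: I] -> nice N) ->
  forall (J : set I) (A : I -> set X),
  (forall i j, i <> j -> finite_set (A i `&` A j)) ->
  (forall i, J i -> [/\ [set: W2] #<= A i, A i #<= K & K #<= A i \/ J #<= A i]) ->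
  exists T, separated W1 W2 J A T.
Proof.
move=> W1P W2P Inice; apply: card_ind => J IH A Aad AJ.
have [JW2|/card_ltNge W2J] := pselect (J #<= [set: W2]).
  by apply: separated_base => // i /AJ[].
have natW1 : [set: nat] #<= [set: W1] by case: W1P => -[].
have W12 : [set: W1] #<= [set: W2] by case: W2P => -[].
have W1inf : infinite_set [set: W1] by apply/infiniteP.
have [i0 Ji0] : J !=set0.
  apply: contrapT => J0; case: W2J => _; apply.
  suff -> : J = set0 by exact: card_ge0.
  by rewrite -subset0 => i Ji; apply: J0; exists i.
(* If K < J, all the sets built below have size at least K and so can contain A i
   together with i; otherwise they are smaller than K, and only N a points of the
   part of A i not yet treated are put into Y a. *)
have [R0 [R0J W2R0 R0K]] : exists R0 : set I, [/\ card_lt R0 J,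
    [set: W2] #<= R0 & K #<= R0 \/ J #<= K].
  have [JK|/card_ltNge KJ] := pselect (J #<= K).
    have [R0 _] := card_le_subset _ _ W2J.1.
    rewrite card_eq_le => /andP[R0W2 W2R0].
    by exists R0; split=> //; [exact: card_le_lt_trans R0W2 W2J|right].
  have [R0 _] := card_le_subset _ _ KJ.1.
  rewrite card_eq_le => /andP[R0K KR0].
  exists R0; split=> //; [exact: card_le_lt_trans R0K KJ| |by left].
  have [W2A AK _] := AJ _ Ji0.
  exact: card_le_trans W2A (card_le_trans AK KR0).
have [R [Rwf Rtr Rtot Rseg]] := initial_wo_exists J.
have Rirr i : ~ R i i.
  move=> Rii.
  by have [x /= -> /(_ _ erefl)] := wf_min R [set i] Rwf (ex_intro _ i erefl).
pose seg a := [set y | J y /\ R y a].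
(* The larger of [R0] and [seg a]: it bounds stage [a], grows with [a] and stays below [J]. *)
pose N a := if seg a #<= R0 then R0 else seg a.
have R0N a : R0 #<= N a.
  rewrite /N; case: ifPn => [//|/negP nle].
  by have [] := card_le_total (seg a) R0.
have segN a : seg a #<= N a by rewrite /N; case: ifPn.
have NJ a : J a -> card_lt (N a) J.
  by move=> Ja; rewrite /N; case: ifPn => // _; exact: Rseg.
have Nmono a b : R b a -> N b #<= N a.
  move=> Rba; rewrite {1}/N; case: ifPn => // _.
  apply: card_le_trans (segN a); apply: subset_card_le => c [Jc Rcb].
  by split=> //; exact: Rtr Rcb Rba.
have W2N a : [set: W2] #<= N a by exact: card_le_trans W2R0 (R0N a).
have Ninf a : infinite_set (N a).
  apply/infiniteP; apply: card_le_trans natW1 _.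
  exact: card_le_trans W12 (W2N a).
have Nnice a : J a -> nice (N a).
  move=> Ja; apply: Inice => //.
  exact: card_lt_le_trans (NJ _ Ja) (card_leT _).
(* A stage is a pair of a set of indices and a set of points. [GL] and [YL] collect the earlier
   stages, and [rest] drops from [A i] the earlier points and the [A j] of earlier indices. *)
pose GL (g : I -> set I * set X) a := \bigcup_(b in seg a) (g b).1.
pose YL (g : I -> set I * set X) a := \bigcup_(b in seg a) (g b).2.
pose rest g a i := A i `\` (YL g a `|` \bigcup_(j in GL g a) A j).
pose Q a g (v : set I * set X) :=
  [/\ GL g a `<=` v.1, v.1 a, YL g a `<=` v.2, v.1 `<=` J & v.1 #<= N a] /\
  [/\ v.2 #<= N a,
      (forall i, J i -> ~ v.1 i -> countable (A i `&` v.2)),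
      (forall i, v.1 i -> K #<= R0 -> A i `<=` v.2) &
      (forall i, v.1 i -> ~ GL g a i -> ~ (K #<= R0) ->
        N a #<= rest g a i `&` v.2)].
have [|h hQ] := wf_rec_choice R (set0, set0) Q Rwf.
  move=> a g g' v gg'.
  have GLE : GL g a = GL g' a by apply: eq_bigcupr => b [_ /gg'->].
  have YLE : YL g a = YL g' a by apply: eq_bigcupr => b [_ /gg'->].
  by rewrite /Q /rest GLE YLE.
have {}hQ a : J a -> Q a h (h a).
  elim/(well_founded_ind Rwf): a => a IHa Ja; apply: hQ.
  have GLN : GL h a #<= N a.
    apply: bigcup_card_le => // b [Jb Rba].
    by have [[_ _ _ _ le] _] := IHa b Rba Jb; exact: card_le_trans le (Nmono _ _ Rba).
  have YLN : YL h a #<= N a.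
    apply: bigcup_card_le => // b [Jb Rba].
    by have [_ [le _ _ _]] := IHa b Rba Jb; exact: card_le_trans le (Nmono _ _ Rba).
  have GLJ : GL h a `<=` J.
    by move=> i [b [Jb Rba] hb]; have [[_ _ _ sub _] _] := IHa b Rba Jb; exact: sub.
  (* Here [J #<= A i], so [N a] is smaller than [A i], while at most [N a] points are removed: those
     in [YL], and finitely many for each [j] in [GL]. *)
  have restN i : J i -> ~ GL h a i -> ~ (K #<= R0) -> N a #<= rest h a i.
    move=> Ji nGL nK; have [//|JK] := R0K.
    have NA : card_lt (N a) (A i).
      apply: card_lt_le_trans (NJ _ Ja) _.
      have [_ _ [KA|//]] := AJ _ Ji; exact: card_le_trans JK KA.
    apply: card_le_trans NA.1 _.
    have -> : rest h a i =
        A i `\` (A i `&` (YL h a `|` \bigcup_(j in GL h a) A j)).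
      by rewrite setDIr setDv set0U.
    apply: card_leD.
      apply/infiniteP; apply: card_le_trans NA.1; exact/infiniteP.
    apply: card_le_lt_trans NA; rewrite setIUr; apply: setU_card_le => //.
      exact: card_le_trans (subset_card_le (@subIsetr _ _ _)) YLN.
    rewrite setI_bigcupr; apply: bigcup_card_le => // j GLj.
    apply: card_le_trans (finite_set_countable _) _; last exact/infiniteP.
    by apply: Aad => ij; apply: nGL; rewrite ij.
  have /choice[S SP] : forall i, exists B, [/\ B #<= N a,
      (J i -> K #<= R0 -> A i `<=` B) &
      (J i -> ~ GL h a i -> ~ (K #<= R0) ->
        exists2 C, C `<=` rest h a i `&` B & N a #<= C)].
    move=> i; have [KR0|nK] := pselect (K #<= R0).
      have [Ji|nJi] := pselect (J i); last by exists set0; split=> //.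
      exists (A i); split=> [|_ _ x //|_ _ /(_ KR0)//]; have [_ AK _] := AJ _ Ji.
      exact: card_le_trans AK (card_le_trans KR0 (R0N a)).
    have [[Ji nGL]|nJ] := pselect (J i /\ ~ GL h a i); last first.
      by exists set0; split=> [|_ /nK//|Ji nGL]; [exact: card_ge0|case: nJ].
    have [B sub] := card_le_subset _ _ (restN _ Ji nGL nK).
    rewrite card_eq_le => /andP[BN NB].
    exists B; split=> [//|_ /nK//|_ _ _]; exists B => // x Bx.
    by split=> //; exact: sub.
  have SN i : S i #<= N a by have [] := SP i.
  have aGLN : a |` GL h a #<= N a.
    apply: setU_card_le => //.
    by apply: card_le_trans (finite_set_countable (finite_set1 a)) _; exact/infiniteP.
  have [G [Y [subG subY GN YN [GY nGY]]]] :=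
    closure_exists (N a) A S (a |` GL h a) (YL h a) (Ninf a) (Nnice _ Ja)
      Aad SN aGLN YLN.
  exists (G `&` J, Y); split; split=> //=.
  - by move=> i GLi; split; [apply: subG; right|exact: GLJ].
  - by split=> //; apply: subG; left.
  - by apply: card_le_trans GN; exact: subset_card_le.
  - by move=> i Ji nGJ; apply: nGY => Gi; apply: nGJ.
  - move=> i [Gi Ji] KR0; have [_ /(_ Ji KR0) AS _] := SP i.
    exact: subset_trans AS (GY _ Gi).
  - move=> i [Gi Ji] nGL nK; have [_ _ /(_ Ji nGL nK)[C Csub NC]] := SP i.
    apply: card_le_trans NC _; apply: subset_card_le => x /Csub[restx Sx].
    by split=> //; exact: GY Sx.
pose D a := (h a).1 `\` GL h a.
pose A' a i := rest h a i `&` (h a).2.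
have YLsmall a i : J a -> J i -> ~ GL h a i -> A i `&` YL h a #<= [set: W1].
  move=> Ja Ji nGL; rewrite setI_bigcupr.
  apply: (chain_bigcup_card_le R) => //; first by case: W1P.
  - by move=> b c [Jb _] [Jc _]; exact: Rtot.
  - move=> b c [Jb _] [Jc _] Rbc x [Ax hbx]; split=> //.
    by have [[_ _ sub _ _] _] := hQ _ Jc; apply: sub; exists b.
  - move=> b [Jb Rba]; have [_ [_ ctbl _ _]] := hQ _ Jb.
    by apply: ctbl => // hbi; apply: nGL; exists b.
have exT a : J a -> exists T, separated W1 W2 (D a) (A' a) T.
  move=> Ja; have [[subG ha _ GJ GN] [YN nGY KY NY]] := hQ _ Ja.
  have DN : D a #<= N a by apply: card_le_trans GN; apply: subset_card_le => i [].
  apply: IH; first exact: card_le_lt_trans DN (NJ _ Ja).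
    move=> i j ij; apply: sub_finite_set (Aad _ _ ij) => x.
    by move=> [[[Aix _] _] [[Ajx _] _]].
  move=> i [Gi nGLi]; have Ji := GJ _ Gi.
  have [W2A AK AKJ] := AJ _ Ji.
  have A'K : A' a i #<= K.
    by apply: card_le_trans AK; apply: subset_card_le => x [[]].
  have [KR0|nK] := pselect (K #<= R0); last first.
    have NA' := NY _ Gi nGLi nK.
    by split=> //; [exact: card_le_trans (W2N a) NA'|right; exact: card_le_trans NA'].
  have KA : K #<= A i.
    by case: AKJ => // JA; apply: card_le_trans KR0 (card_le_trans R0J.1 JA).
  (* Since [K #<= R0], every earlier [A j] already lies in [YL], and [A i] lies in the points of
     stage [a]. The trace therefore loses only [A i] within [YL], at most omega_1 points. *)
  have AA' : A i #<= A' a i.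
    apply: (card_le_trans (B := A i `\` (A i `&` YL h a))).
      apply: card_leD.
        by apply/infiniteP; apply: card_le_trans natW1 (card_le_trans W12 W2A).
      apply: card_le_lt_trans (YLsmall _ _ Ja Ji nGLi) _.
      by apply: card_lt_le_trans W2A; case: W2P.
    apply: subset_card_le => x [Ax nYx]; split; last exact: KY Ax.
    split=> // -[Yx|[j [b [Jb Rba] hbj] Ajx]]; first by apply: nYx.
    apply: nYx; split=> //; exists b => //.
    by have [_ [_ _ KYb _]] := hQ _ Jb; exact: KYb Ajx.
  split=> //; first exact: card_le_trans W2A AA'.
  by left; exact: card_le_trans KA AA'.
have [T TP] := partial_choice (fun=> set0) (fun a T =>
  J a /\ separated W1 W2 (D a) (A' a) T).
have {}TP a : J a -> separated W1 W2 (D a) (A' a) (T a).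
  by move=> Ja; have [U UP] := exT _ Ja; have [] := TP a (ex_intro _ U (conj Ja UP)).
have exD i : J i -> exists a, J a /\ D a i.
  move=> Ji; have [|a [Ja hai] amin] := wf_min R [set a | J a /\ (h a).1 i] Rwf.
    by exists i; split=> //; have [[]] := hQ _ Ji.
  by exists a; do 2!split=> //; move=> [b [Jb Rba] hbi]; exact: (amin b).
have [rk rkP] := partial_choice i0 (fun i a => J a /\ D a i).
have {}rkP i : J i -> J (rk i) /\ D (rk i) i by move=> /exD; exact: rkP.
exists (fun i => T (rk i) i) => i Ji; have [Jr Dr] := rkP _ Ji.
have [TA' W2T TW1] := TP _ Jr _ Dr; split=> //.
  by move=> x /TA'[[]].
apply: (card_le_trans (B := (A i `&` YL h (rk i)) `|`
  (A' (rk i) i `&` \bigcup_(j in D (rk i) `\ i) T (rk i) j))); last first.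
  by apply: setU_card_le => //; apply: YLsmall => //; case: Dr.
apply: subset_card_le => x [Ax [j [Jj /= ji] Tx]].
have [Jrj Drj] := rkP _ Jj.
have [+ _ _] := TP _ Jrj _ Drj; move/(_ _ Tx) => [[Ajx nrest] Yx].
(* For equal ranks the separation inside that stage applies. If [j] came earlier, [x] lies in [YL]
   at the rank of [i]; if later, [rest] for [j] has discarded all of [A i]. *)
have [E|[Rji|Rij]] := Rtot _ _ Jrj Jr.
- rewrite {}E in Drj Tx nrest Yx; right; split; last by exists j.
  by split=> //; split.
- by left; split=> //; exists (rk j).
- exfalso; apply: nrest; right; exists i => //; exists (rk i) => //.
  by case: Dr.
Qed.

(** * The coloring and the theorem *)

(** [f] inverts injections [e i] of [W2] into disjoint parts of the [T i] and is [w0] elsewhere. On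
    [A i] a color other than [w0] can repeat only if it is taken in some other [T j], which spoils
    at most omega_1 colors. *)
Lemma separated_coloring (W1 W2 : Type) {I X : Type} (A T : I -> set X) :
  is_succ_card [set: nat] [set: W1] -> is_succ_card [set: W1] [set: W2] ->
  separated W1 W2 [set: I] A T ->
  exists f : X -> W2, forall i, card_lt ([set: W2] `\` I_f f (A i)) [set: W2].
Proof.
move=> [[natW1 _] _] [W12 _] TP.
have W1inf : infinite_set [set: W1] by apply/infiniteP.
have W2inf : infinite_set [set: W2].
  by apply/infiniteP; apply: card_le_trans natW1 _; case: W12.
have [w0 _] := infinite_setN0 W2inf.
pose T' i := T i `\` \bigcup_(j in [set: I] `\ i) T j.
have T'dis i j x : T' i x -> T' j x -> i = j.
  by move=> [Tix _] [_ nT]; apply: contrapT => ij; apply: nT; exists i.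
have W2T' i : [set: W2] #<= T' i.
  have [TA W2T TW1] := TP i Logic.I; apply: card_le_trans (W2T) _.
  have -> : T' i = T i `\` (T i `&` \bigcup_(j in [set: I] `\ i) T j).
    by rewrite setDIr setDv set0U.
  have Tinf : infinite_set (T i).
    by apply/infiniteP; apply: card_le_trans (W2T); apply/infiniteP.
  apply: card_leD => //; apply: card_lt_le_trans W2T.
  apply: card_le_lt_trans W12; apply: card_le_trans TW1.
  by apply: subset_card_le => x [/TA].
have /choice[e eP] : forall i, exists e : W2 -> X,
    (forall w, T' i (e w)) /\ (forall w w', e w = e w' -> w = w').
  move=> i; have W2T'i := W2T' i.
  have [x _] : T' i !=set0.
    apply: infinite_setN0; apply/infiniteP.
    by apply: card_le_trans (W2T'i); apply/infiniteP.
  have [e [eT eI]] := card_le_fun x W2T'i.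
  by exists e; split=> [w|w w']; [exact: eT|exact: eI].
have /choice[f fP] : forall x, exists w,
    (exists i, e i w = x) \/ ((forall i w', e i w' <> x) /\ w = w0).
  move=> x; have [[i [w <-]]|nex] := pselect (exists i w, e i w = x).
    by exists w; left; exists i.
  by exists w0; right; split=> // i w' ew; apply: nex; exists i, w'.
have fe i w : f (e i w) = w.
  have [[j eji]|[/(_ i w)//]] := fP (e i w).
  have := (eP j).1 (f (e i w)); rewrite eji => Tj.
  have ji := T'dis _ _ _ Tj ((eP i).1 w).
  by rewrite ji in eji; exact: (eP i).2 eji.
exists f => i; have [TA _ TW1] := TP i Logic.I.
apply: card_le_lt_trans W12.
apply: (card_le_trans (B := [set w0] `|`
  f @` (A i `&` \bigcup_(j in [set: I] `\ i) T j))); last first.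
  apply: setU_card_le => //; last exact: card_le_trans (card_image_le _ _) TW1.
  exact: card_le_trans (finite_set_countable (finite_set1 w0)) natW1.
apply: subset_card_le => w [_ nI]; apply: contrapT => nw; apply: nI.
split; first by exists (e i w).
exists (e i w); split.
  by split=> //; apply: TA; have [] := (eP i).1 w.
move=> x [Ax fx]; have [[j ej]|[_ f0]] := fP x; last first.
  by exfalso; apply: nw; left; rewrite -fx.
rewrite fx in ej; have [<-//|ji] := pselect (j = i).
exfalso; apply: nw; right; exists x => //; split=> //; exists j => //.
by rewrite -ej; have [] := (eP j).1 w.
Qed.

Lemma card_lt_eqlr {T U T' U' : Type} {A : set T} {B : set U} {A' : set T'}
  {B' : set U'} : A #= A' -> B #= B' -> card_lt A' B' -> card_lt A B.
Proof.
move=> AA' BB' [A'B' nB'A']; split.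
  by rewrite (card_le_eql AA') (card_le_eqr BB').
by rewrite (card_le_eql BB') (card_le_eqr AA').
Qed.

(** Needed because the cardinal hypothesis of the theorem speaks of types and the counting lemmas of
    subsets. *)
Lemma cf_omega_set_type {T : Type} (A : set T) :
  cf_omega A -> cf_omega [set: A].
Proof.
move=> [Ainf [S [AE SA]]]; split.
  by rewrite (eq_finite_set (card_setT A)).
exists (fun n => [set x : A | S n (val x)]); split.
  apply/seteqP; split=> // x _; have : A (val x) by apply: set_mem; exact: valP.
  by rewrite {1}AE.
move=> n; apply: (card_lt_eqlr _ (card_setT A) (SA n)).
have SnE : val @` [set x : A | S n (val x)] = S n.
  apply/seteqP; split=> [_ [x Sx <-]//|x Sx].
  have Ax : A x by rewrite AE; exists n.
  by exists (SigSub (mem_set Ax)).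
rewrite card_eq_sym -{1}SnE; apply: inj_card_eq => x y _ _; exact: val_inj.
Qed.

Theorem theorem8p6 (TL TR : Type) (HR : is_omega2 TR)
  (HRL : [set: TR] #<= [set: TL])
  (Hcard : forall TM : Type, card_lt [set: TM] [set: TL] ->
           cf_omega [set: TM] -> is_succ_card [set: TM] [set: nat -> TM]) :
  forall TK : Type, [set: TR] #<= [set: TK] -> [set: TK] #<= [set: TL] ->
    arrow TL TK nat TR.
Proof.
move=> TK TRK _ U F [FTL FTK Fad]; have [T1 [natT1 T1R]] := HR.
have natTL : card_lt [set: nat] [set: TL].
  apply: card_lt_le_trans HRL.
  by case: natT1 => nT _; case: T1R => -[T1TR _] _; exact: card_lt_le_trans T1TR.
have Hcof (V M : set TL) : card_lt V [set: TL] -> cf_omega V -> card_lt V M ->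
    pow V #<= M.
  move=> VTL Vcof VM; have VV := card_setT V.
  have [_ Vmin] := Hcard _ (card_lt_eqlr VV (card_eqxx _) VTL)
    (cf_omega_set_type _ Vcof).
  apply: card_le_trans (Vmin _ _ (card_lt_eqlr VV (card_eqxx _) VM)).
  have -> : [set: nat -> V] = pow [set: V] by apply/seteqP.
  by apply: pow_card_le; rewrite (card_le_eqr VV).
(* The cardinal hypothesis at omega itself, which amounts to CH. *)
have Hnat (M : set TL) : card_lt [set: nat] M -> [set: nat -> nat] #<= M.
  have natcof : cf_omega [set: nat].
    split; first exact: infinite_nat.
    exists (fun n => [set n]); split; first by apply/seteqP; split=> // n; exists n.
    by move=> n; apply: card_lt_finite => //; exact: infinite_nat.
  by have [_] := Hcard _ natTL natcof; apply.
move: FTL; rewrite card_eq_sym => /card_set_bijP[A [AF AI AS]].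
have Aad i j : i <> j -> finite_set (A i `&` A j).
  move=> ij; have Aij : A i <> A j by move=> /AI; rewrite !inE => /(_ I I).
  have [_ h] := Fad _ _ (AF i I) (AF j I) Aij.
  by apply: contrapT => /infiniteP.
have nice_TL (N : set TL) : [set: TR] #<= N -> card_lt N [set: TL] -> nice N.
  move=> TRN; apply: uncountable_nice => //; apply: card_lt_le_trans TRN.
  by case: natT1 => nT _; case: T1R => -[T1TR _] _; exact: card_lt_le_trans T1TR.
have [|T TP] := separated_exists T1 TR [set: TK] natT1 T1R nice_TL setT A Aad.
  move=> i _; have := FTK _ (AF i I); rewrite card_eq_le => /andP[AK KA].
  by split=> //; [exact: card_le_trans TRK KA|left].
have [f fP] := separated_coloring T1 TR A T natT1 T1R TP.
by exists f => B /AS[i _ <-].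
Qed.
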